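(* The lattice $\mathcal{P}(n;\epsilon)$ is lexicographically shellable, i.e. it is graded and admits an $EL$-labeling.
   Context: A network on $n$ points is a set $E$ of pairs $(i,j)$ with $1\le i<j\le n$ (directed edges; $i$ a source, $j$ a sink) with no $(i,j),(j,k)\in E$, satisfying (B1): if $(i,k),(j,l)\in E$ with $i<j<k<l$ then $(j,k)\in E$. Let $\epsilon\in\{1,0,-1\}^n$ have first nonzero entry (if any) equal to $1$; $\mathcal{N}(n;\epsilon)$ is the set of such networks in which every source $i$ has $\epsilon_i=1$ and every sink $j$ has $\epsilon_j=-1$. $\mathcal{E}(x)$ is the edge set of $x$, $\rho(x)=|\mathcal{E}(x)|$; $x\lessdot y$ iff $\rho(y)=\rho(x)+1$ and $\mathcal{E}(x)\subset\mathcal{E}(y)$; $x\le y$ iff there is a chain of covers from $x$ to $y$; $\mathcal{P}(n;\epsilon)=(\mathcal{N}(n;\epsilon),\le)$. An edge-labeling assigns to each cover an element of a totally ordered set; a chain $x_0\lessdot\cdots\lessdot x_k$ is rising if its labels are weakly increasing. An $EL$-labeling is one such that every interval $[x,y]$ has a unique rising unrefinable chain $x=x_0\lessdot x_1\lessdot\cdots\lessdot x_k=y$, and whenever $x\lessdot z\le y$, $z\ne x_1$, one has $\lambda(x,x_1)<\lambda(x,z)$. *)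

(* Defs.v *)
From HB Require Import structures.
From mathcomp Require Import all_boot all_order all_algebra.
From mathcomp Require Import zify.

Set Implicit Arguments.
Unset Strict Implicit.
Unset Printing Implicit Defensive.

Import Order.TTheory.

Section LexicographicShellability.
Local Open Scope order_scope.

Definition covers d (P : finPOrderType d) : rel P :=
  [rel x y | (x < y) && [forall z, ~~ ((x < z) && (z < y))]].

Definition is_chain d (P : finPOrderType d) (C : {set P}) : bool :=
  [forall x in C, forall y in C, x >=< y].

(* The usual convention is that a graded poset is bounded and has all its      *)
(* maximal chains of the same length; boundedness is carried by the type.      *)
Definition graded d (P : finTBPOrderType d) : Prop :=
  forall C D : {set P},
    maxset (@is_chain d P) C -> maxset (@is_chain d P) D -> #|C| = #|D|.

Section Labeling.
Variables (d : Order.disp_t) (P : finPOrderType d).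
Variables (dL : Order.disp_t) (L : orderType dL).

(* An edge-labeling is encoded as a total function of two arguments; below,    *)
(* it is only ever evaluated at pairs (x, y) with covers x y.                  *)
Implicit Type lam : P -> P -> L.

(* The chain x = x_0, x_1, ..., x_k = y is encoded as x and [:: x_1; ...; x_k]. *)
Definition unrefinable (x y : P) (c : seq P) : bool :=
  path (@covers d P) x c && (last x c == y).

Definition rising lam (x : P) (c : seq P) : bool :=
  sorted <=%O (pairmap lam x c).

(* When x = y the chain c is empty and the last clause is vacuous; otherwise   *)
(* head x c is x_1.                                                            *)
Definition EL_labeling lam : Prop :=
  forall x y : P, x <= y ->
    exists c : seq P,
      [/\ unrefinable x y c && rising lam x c,
          forall c', unrefinable x y c' && rising lam x c' -> c' = c
        & forall z, covers x z -> z <= y -> z != head x c ->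
            lam x (head x c) < lam x z].

End Labeling.

Definition lexicographically_shellable d (P : finTBPOrderType d) : Prop :=
  graded P /\
  exists (dL : Order.disp_t) (L : orderType dL) (lam : P -> P -> L),
    EL_labeling lam.

End LexicographicShellability.

(* The points 1, ..., n are represented by 'I_n, i.e. shifted to 0, ..., n-1.  *)
Definition is_network n (E : {set 'I_n * 'I_n}) : bool :=
  [&& [forall i : 'I_n, forall j : 'I_n, ((i, j) \in E) ==> (i < j)],
      [forall i : 'I_n, forall j : 'I_n, forall k : 'I_n,
         ~~ (((i, j) \in E) && ((j, k) \in E))]
    & [forall i : 'I_n, forall j : 'I_n, forall k : 'I_n, forall l : 'I_n,
         [&& (i, k) \in E, (j, l) \in E, i < j, j < k & k < l]
           ==> ((j, k) \in E)]].

Definition sign_vector n (eps : {ffun 'I_n -> int}) : Prop :=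
  forall i, eps i \in [:: 1; 0; -1]%R.

Definition first_nonzero_is_one n (eps : {ffun 'I_n -> int}) : Prop :=
  forall i : 'I_n,
    eps i != 0%R -> (forall j : 'I_n, j < i -> eps j = 0%R) -> eps i = 1%R.

Definition compatible n (eps : {ffun 'I_n -> int}) (E : {set 'I_n * 'I_n}) :=
  [forall i, forall j,
     ((i, j) \in E) ==> ((eps i == 1%R) && (eps j == (- 1)%R))].

Record network n (eps : {ffun 'I_n -> int}) := Network {
  edges :> {set 'I_n * 'I_n};
  networkP : is_network edges && compatible eps edges }.

HB.instance Definition _ n (eps : {ffun 'I_n -> int}) :=
  [isSub for @edges n eps].
HB.instance Definition _ n (eps : {ffun 'I_n -> int}) :=
  [Finite of network eps by <:].

Section NetworkOrder.
Variables (n : nat) (eps : {ffun 'I_n -> int}).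
Implicit Types (x y z : network eps) (E F : {set 'I_n * 'I_n}).

Definition network_rank x : nat := #|edges x|.

Definition network_cover : rel (network eps) :=
  [rel x y | (network_rank y == (network_rank x).+1) && (edges x \subset edges y)].

Definition network_le : rel (network eps) := connect network_cover.

Lemma is_networkP E :
  reflect [/\ forall i j, (i, j) \in E -> i < j,
              forall i j k, (i, j) \in E -> (j, k) \in E -> False
            & forall i j k l, (i, k) \in E -> (j, l) \in E ->
                i < j -> j < k -> k < l -> (j, k) \in E]
          (is_network E).
Proof.
apply: (iffP and3P) => [[/forallP h1 /forallP h2 /forallP h3]|[h1 h2 h3]].
  split.
  - by move=> i j; move: (h1 i) => /forallP/(_ j)/implyP.
  - move=> i j k ij jk.
    by move: (h2 i) => /forallP/(_ j)/forallP/(_ k); rewrite ij jk.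
  - move=> i j k l ik jl ij jk kl.
    move: (h3 i) => /forallP/(_ j)/forallP/(_ k)/forallP/(_ l).
    by rewrite ik jl ij jk kl.
split.
- by apply/forallP => i; apply/forallP => j; apply/implyP; apply: h1.
- apply/forallP => i; apply/forallP => j; apply/forallP => k.
  by apply/andP => -[]; apply: h2.
- apply/forallP => i; apply/forallP => j; apply/forallP => k.
  apply/forallP => l; apply/implyP => /and5P[ik jl ij jk kl].
  exact: h3 ik jl ij jk kl.
Qed.

Lemma compatibleP E :
  reflect (forall i j, (i, j) \in E -> eps i = 1%R /\ eps j = (- 1)%R)
          (compatible eps E).
Proof.
apply: (iffP forallP) => h.
  by move=> i j; move: (h i) => /forallP/(_ j)/implyP h' /h' /andP[/eqP-> /eqP->].
move=> i; apply/forallP => j; apply/implyP => /h[-> ->].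
by rewrite !eqxx.
Qed.

Lemma edges_network x : is_network (edges x).
Proof. by case/andP: (networkP x). Qed.

Lemma edges_compatible x : compatible eps (edges x).
Proof. by case/andP: (networkP x). Qed.

Lemma network_le_sub x y : network_le x y -> edges x \subset edges y.
Proof.
case/connectP => p; elim: p x => [|z p IH] x /=; first by move=> _ ->.
case/andP => /andP[_ xz] /IH/[apply]; exact: subset_trans.
Qed.

(* A longest edge of y outside of x can be removed from y: condition (B1) can  *)
(* only force an edge which is shorter than the two edges forcing it.          *)
Lemma network_peel x y :
  edges x \proper edges y -> exists2 z, edges x \subset edges z & network_cover z y.
Proof.
move=> /properP[xy [e0 e0y e0x]].
pose A := edges y :\: edges x.
have A0 : e0 \in A by rewrite inE e0x.
pose len (e : 'I_n * 'I_n) := e.2 - e.1.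
case: (@arg_maxnP _ e0 [in A] len A0) => -[a b] /setDP[aby abx] maxe.
case/is_networkP: (edges_network y) => y1 y2 y3.
case/is_networkP: (edges_network x) => x1 x2 x3.
have inx i j : (i, j) \in edges y -> b - a < j - i -> (i, j) \in edges x.
  move=> ijy lt; apply: contraLR lt => ijx; rewrite -leqNgt.
  by apply: (maxe (i, j)); rewrite !inE ijx.
have netz : is_network (edges y :\ (a, b)) && compatible eps (edges y :\ (a, b)).
  apply/andP; split; last first.
    apply/compatibleP => i j /setD1P[_].
    exact: (compatibleP _ (edges_compatible y)).
  apply/is_networkP; split.
  - by move=> i j /setD1P[_ /y1].
  - by move=> i j k /setD1P[_ ij] /setD1P[_ /(y2 _ _ _ ij)].
  - move=> i j k l /setD1P[_ ik] /setD1P[_ jl] ij jk kl.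
    rewrite !inE (y3 _ _ _ _ ik jl ij jk kl) andbT.
    apply/eqP => -[ja kb]; move: abx; rewrite -ja -kb => /negP; apply.
    apply: (x3 i j k l) => //; apply: inx => //; rewrite -ja -kb; lia.
exists (Network netz) => /=.
  apply/subsetP => e ex; rewrite !inE (subsetP xy) // andbT.
  by apply: contraNneq abx => <-.
apply/andP; split; last exact: subsetDl.
by rewrite /network_rank /= (cardsD1 (a, b) (edges y)) aby.
Qed.

Lemma network_leE x y : network_le x y = (edges x \subset edges y).
Proof.
apply/idP/idP => [|sub]; first exact: network_le_sub.
move: {2}(network_rank y) (leqnn (network_rank y)) => m; elim: m y sub => [|m IH] y sub le.
  have y0 : edges y = set0 by apply/eqP; rewrite -cards_eq0 -leqn0.
  suff -> : x = y by apply: connect0.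
  by apply: val_inj => /=; apply/eqP; rewrite eqEsubset sub y0 sub0set.
have [xy|nxy] := boolP (edges x \proper edges y).
  have [z xz zy] := network_peel xy.
  have /andP[/eqP rk _] := zy.
  apply: connect_trans (connect1 zy); apply: IH => //.
  by move: le; rewrite rk.
suff -> : x = y by apply: connect0.
apply: val_inj => /=; apply/eqP; rewrite eqEsubset sub /=.
by move: nxy; rewrite properE sub /= negbK.
Qed.

Lemma network_le_refl : reflexive network_le.
Proof. by move=> x; rewrite network_leE. Qed.

Lemma network_le_anti : antisymmetric network_le.
Proof.
move=> x y; rewrite !network_leE => xy; apply: val_inj => /=.
by apply/eqP; rewrite eqEsubset.
Qed.

Lemma network_le_trans : transitive network_le.
Proof. exact: connect_trans. Qed.

Lemma network_meet_subproof x y :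
  is_network (edges x :&: edges y) && compatible eps (edges x :&: edges y).
Proof.
case/is_networkP: (edges_network x) => x1 x2 x3.
case/is_networkP: (edges_network y) => y1 y2 y3.
apply/andP; split; last first.
  apply/compatibleP => i j /setIP[+ _].
  exact: (compatibleP _ (edges_compatible x)).
apply/is_networkP; split.
- by move=> i j /setIP[/x1].
- by move=> i j k /setIP[+ _] /setIP[+ _]; apply: x2.
- move=> i j k l /setIP[ikx iky] /setIP[jlx jly] ij jk kl.
  by rewrite inE (x3 i j k l) // (y3 i j k l).
Qed.

Definition network_meet x y := Network (network_meet_subproof x y).

Lemma network_bottom_subproof :
  is_network (set0 : {set 'I_n * 'I_n}) && compatible eps set0.
Proof.
apply/andP; split; last by apply/compatibleP => i j; rewrite inE.
by apply/is_networkP; split=> [i j|i j k|i j k l]; rewrite inE.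
Qed.

Definition network_bottom := Network network_bottom_subproof.

Definition all_edges : {set 'I_n * 'I_n} :=
  [set e : 'I_n * 'I_n | [&& e.1 < e.2, eps e.1 == 1%R & eps e.2 == (- 1)%R]].

Lemma network_top_subproof : is_network all_edges && compatible eps all_edges.
Proof.
apply/andP; split; last first.
  by apply/compatibleP => i j; rewrite inE => /and3P[_ /eqP-> /eqP->].
apply/is_networkP; split=> [i j|i j k|i j k l]; rewrite !inE /=.
- by case/andP.
- by case/and3P => _ _ /eqP-> /and3P[_ /eqP].
- by case/and3P => _ _ -> /and3P[_ -> _] _ -> _.
Qed.

Definition network_top := Network network_top_subproof.

Lemma network_le_bottom x : network_le network_bottom x.
Proof. by rewrite network_leE sub0set. Qed.

Lemma network_le_top x : network_le x network_top.
Proof.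
rewrite network_leE; apply/subsetP => -[i j] ij; rewrite inE /=.
case/is_networkP: (edges_network x) => /(_ _ _ ij)-> _ _.
by case: (compatibleP _ (edges_compatible x) _ _ ij) => -> ->.
Qed.

Lemma network_lexI x y z :
  network_le x (network_meet y z) = network_le x y && network_le x z.
Proof. by rewrite !network_leE subsetI. Qed.

Definition network_join x y : network eps :=
  \big[network_meet/network_top]_(z | network_le x z && network_le y z) z.

Lemma network_leUx x y z :
  network_le (network_join x y) z = network_le x z && network_le y z.
Proof.
apply/idP/idP => [le|xyz].
  have [hx hy] : network_le x (network_join x y) /\ network_le y (network_join x y).
    split; rewrite /network_join; elim/big_ind: _;
      by [exact: network_le_top|move=> u v hu hv; rewrite network_lexI hu|
          move=> u /andP[]].
  by rewrite (network_le_trans hx le) (network_le_trans hy le).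
rewrite /network_join; have := mem_index_enum z.
elim: (index_enum _) => //= w s IH; rewrite inE big_cons => /predU1P[<-|zs].
  by rewrite xyz network_leE subsetIl.
case: ifP => _; last exact: IH.
by apply: network_le_trans (IH zs); rewrite network_leE subsetIr.
Qed.

End NetworkOrder.

Fact network_display : Order.disp_t. Proof. exact: Order.Disp tt tt. Qed.

HB.instance Definition _ n (eps : {ffun 'I_n -> int}) :=
  Order.Le_isPOrder.Build network_display (network eps)
    (@network_le_refl n eps) (@network_le_anti n eps) (@network_le_trans n eps).
HB.instance Definition _ n (eps : {ffun 'I_n -> int}) :=
  Order.hasBottom.Build network_display (network eps)
    (@network_le_bottom n eps).
HB.instance Definition _ n (eps : {ffun 'I_n -> int}) :=
  Order.hasTop.Build network_display (network eps)
    (@network_le_top n eps).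
HB.instance Definition _ n (eps : {ffun 'I_n -> int}) :=
  Order.POrder_isMeetSemilattice.Build network_display (network eps)
    (@network_lexI n eps).
HB.instance Definition _ n (eps : {ffun 'I_n -> int}) :=
  Order.POrder_isJoinSemilattice.Build network_display (network eps)
    (@network_leUx n eps).

Definition network_lattice n (eps : {ffun 'I_n -> int}) :
  finTBLatticeType network_display := network eps.

Lemma covers_network n (eps : {ffun 'I_n -> int}) (x y : network eps) :
  covers x y = network_cover x y.
Proof.
have leE (u v : network eps) : (u <= v)%O = (edges u \subset edges v).
  exact: network_leE.
have ltE (u v : network eps) : (u < v)%O = (edges u \proper edges v).
  by rewrite lt_leAnge !leE properE.
apply/andP/andP => [[]|[/eqP rk sub]].
  rewrite ltE => /network_peel[z xz zy] /forallP/(_ z).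
  have /andP[/eqP rk szy] := zy.
  have -> : (z < y)%O.
    by rewrite ltE properEcard szy; move: rk; rewrite /network_rank; lia.
  rewrite andbT lt_neqAle leE xz andbT negbK => /eqP->.
  by rewrite rk eqxx szy.
rewrite /network_rank in rk; split; first by rewrite ltE properEcard sub rk /=.
apply/forallP => z; apply/negP; rewrite !ltE => /andP[/proper_card h /proper_card].
by lia.
Qed.

(* Main.v *)
(* Order the edges (a, b) by length b - a, refined to a total order, and label
   the cover x < x + e by e.  In (B1) the forced edge (j, k) is strictly shorter
   than both (i, k) and (j, l); hence adding to x the edges of y :\: x in
   increasing order never leaves the set of networks.  Every maximal chain of
   [x, y] uses each edge of y :\: x exactly once, so this chain is the only
   rising one.  Gradedness follows from [network_peel]: a maximal chain cannot
   skip a cardinality. *)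

Require Import Defs.
From mathcomp Require Import all_boot all_order all_algebra.
From mathcomp Require Import zify.

Set Implicit Arguments.
Unset Strict Implicit.
Unset Printing Implicit Defensive.

Import Order.TTheory.

Section Shellability.
Variables (n : nat) (eps : {ffun 'I_n -> int}).
Implicit Types (x y z u v : network eps) (e f : 'I_n * 'I_n).

(** * Rank, maximal chains and gradedness *)

Lemma le_networkE x y : (x <= y)%O = (edges x \subset edges y).
Proof. exact: network_leE. Qed.

Lemma edges_inj : injective (@edges n eps).
Proof. exact: val_inj. Qed.

Lemma network_rank_le x y : (x <= y)%O -> network_rank x <= network_rank y.
Proof. by rewrite le_networkE => /subset_leq_card. Qed.

Lemma network_le_rank_eq x y :
  (x <= y)%O -> network_rank x = network_rank y -> x = y.
Proof.
rewrite le_networkE => xy rk; apply: edges_inj; apply/eqP.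
by rewrite eqEcard xy -!/(network_rank _) rk /=.
Qed.

Lemma maxset_chain_mem (C : {set network eps}) z :
  maxset (@is_chain _ _) C -> {in C, forall u, (u >=< z)%O} -> z \in C.
Proof.
move=> /maxsetP[/forall_inP chC maxC] Cz.
suff <- : z |: C = C by exact: setU11.
apply: maxC (subsetUr _ _).
apply/forall_inP => u /setU1P[->|uC]; apply/forall_inP => v /setU1P[->|vC].
- exact: comparablexx.
- by rewrite comparable_sym; apply: Cz.
- exact: Cz.
- by move/forall_inP: (chC u uC); apply.
Qed.

(** If [C] skipped [r], peeling one edge off its lowest element [y] above rank [r] would give a
    network comparable to all of [C]. By maximality it lies in [C], which contradicts the choice of
    [y]. *)
Lemma maxset_chain_rank (C : {set network eps}) r :
  maxset (@is_chain _ _) C -> r <= network_rank (network_top eps) ->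
  exists2 x, x \in C & network_rank x = r.
Proof.
move=> mC rtop; have [/forall_inP chC _] := maxsetP mC.
have comp u v : u \in C -> v \in C -> (u >=< v)%O.
  by move=> uC vC; move/forall_inP: (chC u uC); apply.
have botC : network_bottom eps \in C.
  by apply: maxset_chain_mem => // u _; rewrite /Order.comparable le_networkE
    [X in _ || X]le_networkE sub0set orbT.
have topC : network_top eps \in C.
  by apply: maxset_chain_mem => // u _; apply/orP; left; apply: network_le_top.
have [/existsP[x /andP[xC /eqP <-]]|] :=
  boolP [exists x in C, network_rank x == r]; first by exists x.
rewrite negb_exists_in => /forall_inP nr; exfalso.
have bot0 : network_rank (network_bottom eps) = 0 by rewrite /network_rank cards0.
pose lo := [pred u | (u \in C) && (network_rank u < r)].
pose hi := [pred u | (u \in C) && (r < network_rank u)].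
have lob : lo (network_bottom eps).
  by rewrite /= botC bot0; have := nr _ botC; rewrite bot0 lt0n eq_sym.
have hit : hi (network_top eps).
  by rewrite /= topC ltn_neqAle rtop eq_sym (nr _ topC).
case: (arg_maxnP (@network_rank _ _) lob) => x /andP[xC xr] maxx.
case: (arg_minnP (@network_rank _ _) hit) => y /andP[yC yr] miny.
(* Inside a chain, the rank alone decides the order. *)
have rank_comp u v : u \in C -> v \in C ->
    network_rank u <= network_rank v -> (u <= v)%O.
  move=> uC vC uv; case/orP: (comp _ _ uC vC) => // vu.
  suff -> : v = u by [].
  by apply: network_le_rank_eq => //; have := network_rank_le vu; lia.
have xy : edges x \proper edges y.
  have : (x <= y)%O by apply: rank_comp => //; lia.
  rewrite le_networkE properEcard => ->.
  by rewrite -!/(network_rank _) (ltn_trans xr yr).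
have [z xz /andP[/eqP yz zy]] := network_peel xy.
(* As no rank in [C] equals [r], each element of [C] is below [x] or above [y], and [z] lies between
   the two. *)
have zC : z \in C.
  apply: maxset_chain_mem => // u uC; apply/orP.
  have := nr _ uC; rewrite neq_ltn => /orP[ur|ur]; [left|right].
    apply: (@le_trans _ _ x); last by rewrite le_networkE.
    by apply: rank_comp => //; apply: maxx; rewrite /= uC.
  apply: (@le_trans _ _ y); first by rewrite le_networkE.
  by apply: rank_comp => //; apply: miny; rewrite /= uC.
have := nr _ zC; rewrite neq_ltn => /orP[zr|zr]; first by lia.
have : network_rank y <= network_rank z by apply: miny; rewrite /= zC.
lia.
Qed.

(** The rank is a bijection from [C] onto the integers from 0 to the rank of the top. *)
Lemma card_maxset_chain (C : {set network eps}) :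
  maxset (@is_chain _ _) C -> #|C| = (network_rank (network_top eps)).+1.
Proof.
move=> mC; have [/forall_inP chC _] := maxsetP mC.
pose N := network_rank (network_top eps).
pose rk (u : network eps) : 'I_N.+1 := inord (network_rank u).
have rkE u : rk u = network_rank u :> nat.
  by rewrite inordK // ltnS network_rank_le //; apply: network_le_top.
have rk_inj : {in C &, injective rk}.
  move=> u v uC vC /(congr1 val) /=; rewrite !rkE => uv.
  have /forall_inP/(_ v vC)/orP[le|le] := chC u uC.
    exact: network_le_rank_eq.
  exact/esym/network_le_rank_eq.
rewrite -(card_in_imset rk_inj) -[RHS]card_ord -cardsT; congr #|pred_of_set _|.
apply/setP => r; rewrite inE; apply/imsetP.
have [|x xC xr] := @maxset_chain_rank C r mC; first by rewrite -ltnS.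
by exists x => //; apply: val_inj; rewrite /= rkE.
Qed.

Lemma network_graded : graded (network_lattice eps).
Proof. by move=> C D /card_maxset_chain-> /card_maxset_chain->. Qed.

(** * The labeling of covers by edges *)

Definition edge_code e : nat := (e.2 - e.1) * n + e.1.

Lemma edge_lt x e : e \in edges x -> e.1 < e.2.
Proof. by case: e => i j; case/is_networkP: (edges_network x) => + _ _; apply. Qed.

(** The code is a two-digit number in base [n]: length, then source. The digits determine the sink
    only if [e.1 < e.2], as subtraction is truncated; hence the restriction to edges. *)
Lemma edge_code_inj x : {in edges x &, injective edge_code}.
Proof.
move=> [a b] [c d] /edge_lt/= ab /edge_lt/= cd; rewrite /edge_code /= => eq_code.
have [an cn] := (ltn_ord a, ltn_ord c); have n0 : 0 < n by lia.
have ac : a = c :> nat.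
  by move/(congr1 (modn^~ n)): eq_code; rewrite /= !modnMDl !modn_small.
have len : b - a = d - c.
  by move/(congr1 (divn^~ n)): eq_code; rewrite /= !divnMDl // !divn_small ?addn0.
by congr pair; apply: val_inj => /=; lia.
Qed.

(** One more unit of length adds [n] to the code, which outweighs any source. *)
Lemma edge_code_lt_length e f : e.2 - e.1 < f.2 - f.1 -> edge_code e < edge_code f.
Proof.
rewrite /edge_code => lt; have := ltn_ord e.1.
have := leq_mul lt (leqnn n); rewrite mulSn; lia.
Qed.

(* The sum has a single term when y covers x. *)
Definition edge_label x y : nat := \sum_(e in edges y :\: edges x) edge_code e.

Lemma coversP x y :
  reflect (exists2 e, e \notin edges x & edges y = e |: edges x) (covers x y).
Proof.
rewrite covers_network /=; apply: (iffP andP) => [[/eqP rk sub]|[e ex yE]].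
  have /cards1P[e De] : #|edges y :\: edges x| == 1.
    rewrite cardsD (setIidPr sub); rewrite /network_rank in rk; apply/eqP; lia.
  have : e \in edges y :\: edges x by rewrite De set11.
  case/setDP => ey ex; exists e => //.
  by rewrite -De setUC -{1}(setIidPr sub) setID.
by rewrite /network_rank yE cardsU1 ex eqxx subsetUr.
Qed.

Lemma edge_label_cover x y e :
  e \notin edges x -> edges y = e |: edges x -> edge_label x y = edge_code e.
Proof.
move=> ex yE; rewrite /edge_label yE setDUl setDv setU0.
by rewrite (setDidPl _) ?big_set1 // disjoints1.
Qed.

(* A violation of (B1) in [e |: edges x] would give a shorter edge of y outside
   of x. *)
Lemma network_add_min_edge x y e :
  edges x \subset edges y -> e \in edges y :\: edges x ->
  {in edges y :\: edges x, forall f, edge_code e <= edge_code f} ->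
  exists2 z : network eps, edges z = e |: edges x & edges z \subset edges y.
Proof.
move=> xy /setDP[ey ex] mine.
have zy : e |: edges x \subset edges y by rewrite subUset sub1set ey.
have /is_networkP[y1 y2 y3] := edges_network y.
have /is_networkP[x1 x2 x3] := edges_network x.
have netz : is_network (e |: edges x) && compatible eps (e |: edges x).
  apply/andP; split; last first.
    apply/compatibleP => i j /(subsetP zy).
    exact: (compatibleP _ _ (edges_compatible y)).
  apply/is_networkP; split.
  - by move=> i j /(subsetP zy)/y1.
  - by move=> i j k /(subsetP zy) ij /(subsetP zy)/(y2 _ _ _ ij).
  - move=> i j k l ik jl ij jk kl; apply/setU1P; right.
    have jky : (j, k) \in edges y.
      by apply: (y3 i j k l) => //; apply: (subsetP zy).
    apply/negPn/negP => jkx.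
    have le_e : edge_code e <= edge_code (j, k) by apply: mine; rewrite inE jkx.
    (* By minimality [e] is not longer than [(j, k)], so the longer edges [(i, k)] and [(j, l)] are
       already in [x], where (B1) applies. *)
    have inx f : f \in e |: edges x -> k - j < f.2 - f.1 -> f \in edges x.
      move=> /setU1P[-> lt|//]; have := @edge_code_lt_length (j, k) e lt; lia.
    by case/negP: jkx; apply: (x3 i j k l) => //; apply: inx => //=; lia.
by exists (Network netz).
Qed.

(** * Rising chains in an interval *)

Lemma unrefinable_le x y c : unrefinable x y c -> (x <= y)%O.
Proof.
case/andP; elim: c x => [|z c IH] x /=; first by move=> _ /eqP->.
case/andP => /andP[xz _] pc /(IH _ pc).
exact: le_trans (ltW xz).
Qed.

(** Some cover of the chain has to add [e]. This is what rules out a rising chain that postpones the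
    smallest missing edge. *)
Lemma edge_code_in_labels x y c e :
  unrefinable x y c -> e \in edges y -> e \notin edges x ->
  edge_code e \in pairmap edge_label x c.
Proof.
case/andP; elim: c x => [|z c IH] x /=; first by move=> _ /eqP-> ->.
case/andP => /coversP[f fx zE] pc cy ey ex; rewrite inE.
have [->|ef] := eqVneq e f; first by rewrite (edge_label_cover fx zE) eqxx.
by rewrite (IH z) ?orbT // zE !inE negb_or ef ex.
Qed.

Lemma edge_label_le x y z :
  covers x z -> (z <= y)%O ->
  exists2 f, f \in edges y :\: edges x
    & edge_label x z = edge_code f /\ edges z = f |: edges x.
Proof.
case/coversP => f fx zE; rewrite le_networkE zE subUset sub1set => /andP[fy _].
by exists f; rewrite ?inE ?fx // (edge_label_cover fx zE).
Qed.

(** Induction on the number of edges missing from [x]: the rising chain first adds the missing edge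
    [e] of least code, then follows the rising chain from [x1] to [y]. *)
Lemma edge_label_EL : EL_labeling edge_label.
Proof.
move=> x y; move: {2}#|_| (erefl #|edges y :\: edges x|) => m.
elim: m x => [|m IH] x card_yx le_xy.
  have {le_xy card_yx} <- : x = y.
    apply/le_anti; rewrite le_xy le_networkE -setD_eq0 -cards_eq0.
    by rewrite card_yx.
  have no_cover z : covers x z -> (z <= x)%O -> False.
    by case/andP => xz _ zx; have := lt_le_trans xz zx; rewrite ltxx.
  exists [::]; split=> [|[|z c] // /andP[/andP[/andP[xz pc] cx] _]|z xz zx].
  - by rewrite /unrefinable /rising /= eqxx.
  - by case: (no_cover z xz); apply: (@unrefinable_le z x c); apply/andP.
  - by case: (no_cover z).
have /card_gt0P[e0 e0yx] : 0 < #|edges y :\: edges x| by rewrite card_yx.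
case: (@arg_minnP _ e0 [in edges y :\: edges x] edge_code e0yx) => e eyx mine.
have /setDP[ey ex] := eyx; have sub_xy := le_xy; rewrite le_networkE in sub_xy.
have [x1 x1E sub_x1y] := network_add_min_edge sub_xy eyx mine.
have lab_e := edge_label_cover ex x1E.
have x1y : (x1 <= y)%O by rewrite le_networkE.
have cov_x1 : covers x x1 by apply/coversP; exists e.
have [|c [/andP[unr_c ris_c] uniq_c _]] := IH x1 _ x1y.
  have -> : edges y :\: edges x1 = (edges y :\: edges x) :\ e.
    by rewrite x1E setDDl setUC.
  by move: card_yx; rewrite (cardsD1 e) eyx; case.
have head_min z : covers x z -> (z <= y)%O -> z != x1 ->
    edge_label x x1 < edge_label x z.
  move=> xz zy; apply: contraNltn.
  have [f fyx [-> zE]] := edge_label_le xz zy; rewrite lab_e => le_fe.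
  have fe : f = e.
    have [/setDP[fy _]] := fyx; apply: (@edge_code_inj y) => //.
    by apply/eqP; rewrite eqn_leq le_fe; apply: mine.
  by apply/eqP/edges_inj; rewrite zE x1E fe.
exists (x1 :: c); split; last by move=> z xz zy; apply: head_min.
  rewrite /unrefinable /rising /= cov_x1 -/(unrefinable x1 y c) unr_c /=.
  (* Only the first two labels remain to be compared; the second is the code of another edge missing
     from [x], hence at least that of [e]. *)
  case: c unr_c ris_c {uniq_c} => //= x2 c unr_c; rewrite /rising /= => ->; rewrite andbT.
  have /andP[/= /andP[x12 pc] cy] := unr_c.
  have x2y : (x2 <= y)%O by apply: (@unrefinable_le x2 y c); apply/andP.
  have [f /setDP[fy fx1] [-> _]] := edge_label_le x12 x2y.
  rewrite lab_e leEnat; apply: mine; rewrite inE fy andbT.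
  by apply: contra fx1; rewrite x1E => fx; rewrite inE fx orbT.
case=> [/andP[/andP[_ /= /eqP xy] _]|z c' /andP[/andP[/= /andP[xz pc'] c'y] ris]].
  by rewrite -xy (negPf ex) in ey.
have unr_c' : unrefinable z y c' by apply/andP.
have zy := unrefinable_le unr_c'.
have [zx1|zx1] := eqVneq z x1.
  subst z; congr cons; apply: uniq_c; rewrite unr_c' /=.
  by move: ris; rewrite /rising /= => /path_sorted.
have lt_lab := head_min z xz zy zx1.
(* If [z] differs from [x1], then [e] is added later, with a label strictly below the first one; but
   the first label of a rising chain is its least. *)
have ez : e \notin edges z.
  have [f _ [labz ->]] := edge_label_le xz zy.
  rewrite !inE negb_or ex andbT; apply: contraTneq lt_lab => ef.
  by rewrite labz lab_e ef ltnn.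
have := order_path_min (@le_trans _ _) ris.
move/allP/(_ _ (edge_code_in_labels unr_c' ey ez)).
by rewrite leEnat leqNgt -lab_e lt_lab.
Qed.

End Shellability.

Theorem theorem5p6 (n : nat) (eps : {ffun 'I_n -> int}) :
  sign_vector eps -> first_nonzero_is_one eps ->
  lexicographically_shellable (network_lattice eps).
Proof.
move=> _ _; split; first exact: network_graded.
exists _, nat, (@edge_label n eps); exact: edge_label_EL.
Qed.
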